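(* Let $(T_n)_{n\in\mathbb N}$ be an approximately geometric sequence in the semiring of tensors. Then the sequence has the Kronecker scaling property.
   Context: Semiring of tensors: a ($3$-)tensor is an element of $V_1\otimes V_2\otimes V_3$ with $V_j$ finite-dimensional complex vector spaces. A tensor $s\in V_1\otimes V_2\otimes V_3$ restricts to $t\in W_1\otimes W_2\otimes W_3$ (and $t$ is called a restriction of $s$), written $t\le s$, if $t=(A_1\otimes A_2\otimes A_3)s$ for some linear maps $A_j:V_j\to W_j$; $s,t$ are equivalent if each restricts to the other. The set of equivalence classes of tensors, with direct sum $\oplus$ as addition, Kronecker (tensor) product $\otimes$ as multiplication and the preorder $\le$, is a preordered semiring. Natural numbers $r$ correspond to unit tensors $\langle r\rangle=\sum_{i=1}^re_i\otimes e_i\otimes e_i$. Approximately geometric sequences: $\mathbb N$ includes $0$; a sublinear sequence is a sequence $(k_n)_{n\in\mathbb N}$ in $\mathbb N$ with $k_n/n\to0$. Sequences of tensors satisfy $a\approx b$ if for some sublinear $(k_n)$ one has $a_n\le\langle2\rangle^{\otimes k_n}\otimes b_n$ and $b_n\le\langle 2\rangle^{\otimes k_n}\otimes a_n$ for all $n$. A sequence $(T_n)_{n\in\mathbb N}$ is approximately geometric if either $T\approx(1,0,0,\dots)$, or all $T_n$ are nonzero and there is a sublinear sequence $(k_n)$ such that for all $t\in\mathbb N_{>0}$ and $n_1,\dots,n_t\in\mathbb N$ both $T_{n_1}\otimes\cdots\otimes T_{n_t}\le\langle2\rangle^{\otimes(k_{n_1}+\dots+k_{n_t})}\otimes T_{n_1+\dots+n_t}$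 and $T_{n_1+\dots+n_t}\le\langle2\rangle^{\otimes(k_{n_1}+\dots+k_{n_t})}\otimes T_{n_1}\otimes\cdots\otimes T_{n_t}$ hold. A sequence of $3$-tensors $T_0,T_1,T_2,\dots$ has the Kronecker scaling property if for all $\delta>0$ there exist infinitely many $d=1,2,\dots$ such that for all large enough $n=1,2,\dots$ in an arithmetic progression, the tensor $T_n$ is a sum of at most $2^{\delta n}$ tensors, each of which is a restriction of $T_d^{\otimes s}$ for $s\le(1+\delta)n/d$. *)

(* Defs.v *)
From HB Require Import structures.
From mathcomp Require Import all_boot all_order all_algebra.
From mathcomp Require Import complex mxtens.
From mathcomp Require Import all_classical all_reals all_analysis.

Set Implicit Arguments.
Unset Strict Implicit.
Unset Printing Implicit Defensive.

Import Order.TTheory GRing.Theory Num.Theory.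
Import numFieldNormedType.Exports.

Local Open Scope ring_scope.
Local Open Scope classical_set_scope.

(* The space F^a (x) F^b (x) F^c, in coordinates with respect to the standard
   bases. A notation, so that it keeps the zmodType structure of {ffun _}. *)
Notation tensor_space F a b c := {ffun 'I_a * 'I_b * 'I_c -> F}.

Record tensor (F : fieldType) := Tensor {
  dim1 : nat;
  dim2 : nat;
  dim3 : nat;
  coefs :> tensor_space F dim1 dim2 dim3
}.

(* t = (A1 (x) A2 (x) A3) s, the linear maps A_j being given by their matrices
   acting on column vectors. *)
Definition tensor_le (F : fieldType) (t s : tensor F) : Prop :=
  exists (A1 : 'M[F]_(dim1 t, dim1 s))
         (A2 : 'M[F]_(dim2 t, dim2 s))
         (A3 : 'M[F]_(dim3 t, dim3 s)),
    forall i j k, t (i, j, k) =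
      \sum_(i' < dim1 s) \sum_(j' < dim2 s) \sum_(k' < dim3 s)
        A1 i i' * A2 j j' * A3 k k' * s (i', j', k').

(* mxtens_unindex : 'I_(m * n) -> 'I_m * 'I_n identifies F^(m * n) with
   F^m (x) F^n, as in the Kronecker product of matrices. *)
Definition tensor_kron (F : fieldType) (s t : tensor F) : tensor F :=
  @Tensor F (dim1 s * dim1 t) (dim2 s * dim2 t) (dim3 s * dim3 t)
    [ffun x => let: (i, j, k) := x in
       s ((mxtens_unindex i).1, (mxtens_unindex j).1, (mxtens_unindex k).1) *
       t ((mxtens_unindex i).2, (mxtens_unindex j).2, (mxtens_unindex k).2)].

Definition unit_tensor (F : fieldType) (r : nat) : tensor F :=
  @Tensor F r r r
    [ffun x => let: (i, j, k) := x in ((i == j) && (j == k))%:R].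

Definition tensor_pow (F : fieldType) (t : tensor F) (n : nat) : tensor F :=
  iter n (tensor_kron t) (unit_tensor F 1).

Definition sublinear (R : realType) (k : nat -> nat) : Prop :=
  (fun n => (k n)%:R / n%:R : R) @ \oo --> (0 : R).

Definition tensor_approx (R : realType) (a b : nat -> tensor R[i]) : Prop :=
  exists2 k : nat -> nat, sublinear R k &
    forall n,
      tensor_le (a n)
        (tensor_kron (tensor_pow (unit_tensor R[i] 2) (k n)) (b n)) /\
      tensor_le (b n)
        (tensor_kron (tensor_pow (unit_tensor R[i] 2) (k n)) (a n)).

Definition approx_geometric (R : realType) (T : nat -> tensor R[i]) : Prop :=
  tensor_approx T
    (fun n => if n == 0%N then unit_tensor R[i] 1 else unit_tensor R[i] 0) \/
  ((forall n, coefs (T n) != 0) /\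
   exists2 k : nat -> nat, sublinear R k &
     forall (t : nat) (n : 'I_t -> nat), (0 < t)%N ->
       let e := tensor_pow (unit_tensor R[i] 2) (\sum_(i < t) k (n i))%N in
       let prodT :=
         \big[@tensor_kron R[i]/unit_tensor R[i] 1]_(i < t) T (n i) in
       let Tsum := T (\sum_(i < t) n i)%N in
       tensor_le prodT (tensor_kron e Tsum) /\
       tensor_le Tsum (tensor_kron e prodT)).

Definition sum_of_restrictions (R : realType) (T : nat -> tensor R[i])
    (delta : R) (d n : nat) : Prop :=
  exists (r : nat)
         (S : 'I_r -> tensor_space R[i] (dim1 (T n)) (dim2 (T n)) (dim3 (T n))),
    [/\ r%:R <= 2 `^ (delta * n%:R),
        coefs (T n) = \sum_(l < r) S l &
        forall l : 'I_r, exists2 s : nat,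
          s%:R <= (1 + delta) * n%:R / d%:R &
          tensor_le (Tensor (S l)) (tensor_pow (T d) s)].

(* The arithmetic progression a, a + b, a + 2b, ... may depend on delta and on
   d, as may the meaning of "large enough". *)
Definition kronecker_scaling (R : realType) (T : nat -> tensor R[i]) : Prop :=
  forall delta : R, 0 < delta ->
    infinite_set [set d : nat | (0 < d)%N /\
      exists a b : nat, (0 < b)%N /\
        \forall m \near \oo, sum_of_restrictions T delta d (a + m * b)%N].

(* Main.v *)
Require Import Defs.
From mathcomp Require Import all_boot all_order all_algebra.
From mathcomp Require Import complex mxtens.
From mathcomp Require Import all_classical all_reals all_analysis.
From mathcomp Require Import ring.

(** If [n = m * d] then [T n] is a restriction of [<2>^(m * k d) (x) T_d^m].
    Since [<2>^(m * k d)] is a sum of [2^(m * k d)] rank-one tensors, this writes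
    [T n] as a sum of [2^(m * k d) = 2^((k d / d) * n)] restrictions of [T_d^m],
    and [k d / d <= delta] for all large [d]. *)

Set Implicit Arguments.
Unset Strict Implicit.
Unset Printing Implicit Defensive.

Import Order.TTheory GRing.Theory Num.Theory.
Import numFieldNormedType.Exports.

Local Open Scope ring_scope.
Local Open Scope classical_set_scope.

Section RankDecomposition.
Variable F : fieldType.
Implicit Types (s t E X : tensor F) (r n : nat).

(** Tensor rank at most [r]: summands may vanish, so a sum of exactly [r] simple tensors covers
    smaller ranks. *)
Definition rank_le t r : Prop :=
  exists (u : 'I_r -> 'I_(dim1 t) -> F) (v : 'I_r -> 'I_(dim2 t) -> F)
         (w : 'I_r -> 'I_(dim3 t) -> F),
    forall i j k, t (i, j, k) = \sum_(l < r) u l i * v l j * w l k.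

Lemma rank_le_unit_tensor r : rank_le (unit_tensor F r) r.
Proof.
exists (fun l i => (i == l)%:R), (fun l i => (i == l)%:R),
  (fun l i => (i == l)%:R) => i j k.
rewrite ffunE (bigD1 i) //= big1 ?addr0 => [|l li]; last first.
  by rewrite eq_sym (negbTE li) !mul0r.
rewrite eqxx mul1r -natrM mulnb.
by case: eqVneq => [->|]; rewrite ?eqxx //= eq_sym.
Qed.

Lemma rank_le_kron s t r1 r2 :
  rank_le s r1 -> rank_le t r2 -> rank_le (tensor_kron s t) (r1 * r2).
Proof.
move=> [us [vs [ws Es]]] [ut [vt [wt Et]]].
exists (fun l i => us (mxtens_unindex l).1 (mxtens_unindex i).1 *
                   ut (mxtens_unindex l).2 (mxtens_unindex i).2),
       (fun l i => vs (mxtens_unindex l).1 (mxtens_unindex i).1 *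
                   vt (mxtens_unindex l).2 (mxtens_unindex i).2),
       (fun l i => ws (mxtens_unindex l).1 (mxtens_unindex i).1 *
                   wt (mxtens_unindex l).2 (mxtens_unindex i).2) => i j k.
rewrite ffunE Es Et mulr_sum.
by apply: eq_bigr => l _; ring.
Qed.

Lemma rank_le_pow t r n : rank_le t r -> rank_le (tensor_pow t n) (r ^ n).
Proof.
move=> tr; elim: n => [|n IHn]; first exact: rank_le_unit_tensor.
by rewrite expnS; apply: rank_le_kron.
Qed.

(** Contraction of one leg of a Kronecker product: the vector [a] of the first factor is absorbed
    into the row [A], which leaves a row acting on the second factor alone. *)
Lemma sum_mxtens m n (A : 'I_(m * n) -> F) (a : 'I_m -> F) (x : 'I_n -> F) :
  \sum_(i < m * n) A i * (a (mxtens_unindex i).1 * x (mxtens_unindex i).2) =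
  \sum_(p < n) (\sum_(q < m) A (mxtens_index (q, p)) * a q) * x p.
Proof.
rewrite (reindex (@mxtens_index m n)); last first.
  by exists (@mxtens_unindex m n) => i _; rewrite (mxtens_indexK, mxtens_unindexK).
under [RHS]eq_bigr do rewrite mulr_suml.
rewrite exchange_big pair_bigA.
by apply: eq_bigr => -[q p] _; rewrite mxtens_indexK mulrA.
Qed.

(** Split [E] into simple tensors [u l (x) v l (x) w l]. Plugging these vectors into the [E]-part of
    the maps [A1], [A2], [A3] gives maps [B1 l], [B2 l], [B3 l] defined on the spaces of [X], and
    these send [X] to the [l]-th summand of [t]. *)
Lemma tensor_le_kron_rank t E X r : rank_le E r -> tensor_le t (tensor_kron E X) ->
  exists S : 'I_r -> tensor_space F (dim1 t) (dim2 t) (dim3 t),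
    coefs t = \sum_(l < r) S l /\ forall l, tensor_le (Tensor (S l)) X.
Proof.
move=> [u [v [w Euvw]]] [A1 [A2 [A3 tA]]].
pose B1 l := \matrix_(i, p) \sum_q A1 i (mxtens_index (q, p)) * u l q.
pose B2 l := \matrix_(i, p) \sum_q A2 i (mxtens_index (q, p)) * v l q.
pose B3 l := \matrix_(i, p) \sum_q A3 i (mxtens_index (q, p)) * w l q.
exists (fun l => [ffun x => let: (i, j, k) := x in
  \sum_(i' < dim1 X) \sum_(j' < dim2 X) \sum_(k' < dim3 X)
    B1 l i i' * B2 l j j' * B3 l k k' * X (i', j', k')]).
split; last by move=> l; exists (B1 l), (B2 l), (B3 l) => i j k; rewrite ffunE.
apply/ffunP => -[[i j] k]; rewrite sum_ffunE tA.
(* In this nested form each sum encloses only what depends on its index, so [sum_mxtens] can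
   contract the three legs one by one, from the outside in. *)
transitivity (\sum_(l < r) \sum_i' A1 i i' * (u l (mxtens_unindex i').1 *
  \sum_j' A2 j j' * (v l (mxtens_unindex j').1 *
  \sum_k' A3 k k' * (w l (mxtens_unindex k').1 * X ((mxtens_unindex i').2,
    (mxtens_unindex j').2, (mxtens_unindex k').2))))).
  rewrite [RHS]exchange_big; apply: eq_bigr => i' _ /=.
  under [RHS]eq_bigr do rewrite !mulr_sumr.
  rewrite [RHS]exchange_big; apply: eq_bigr => j' _ /=.
  under [RHS]eq_bigr do rewrite !mulr_sumr.
  rewrite [RHS]exchange_big; apply: eq_bigr => k' _ /=.
  rewrite ffunE Euvw mulr_suml mulr_sumr.
  by apply: eq_bigr => l _; ring.
apply: eq_bigr => l _; rewrite ffunE.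
rewrite (sum_mxtens _ _ (fun p => \sum_j' A2 j j' * (v l (mxtens_unindex j').1 *
  \sum_k' A3 k k' * (w l (mxtens_unindex k').1 *
    X (p, (mxtens_unindex j').2, (mxtens_unindex k').2))))).
apply: eq_bigr => p1 _.
rewrite (sum_mxtens _ _ (fun p => \sum_k' A3 k k' *
  (w l (mxtens_unindex k').1 * X (p1, p, (mxtens_unindex k').2)))) mulr_sumr.
apply: eq_bigr => p2 _.
rewrite (sum_mxtens _ _ (fun p => X (p1, p2, p))) !mulr_sumr.
by apply: eq_bigr => p3 _; rewrite !mxE; ring.
Qed.

Lemma tensor_le_kron_unit0 t E :
  tensor_le t (tensor_kron E (unit_tensor F 0)) -> coefs t = 0.
Proof.
move=> [A1 [A2 [A3 tA]]]; apply/ffunP => -[[i j] k]; rewrite tA ffunE.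
by apply: big1 => -[i' i'_lt] _; exfalso; rewrite /= muln0 in i'_lt.
Qed.

End RankDecomposition.

Lemma near_infty_infinite_set (A : set nat) :
  (\forall n \near \oo, A n) -> infinite_set A.
Proof.
move=> [N _ NA]; apply: (cofinite_set_infinite infinite_nat).
apply: (sub_finite_set _ (finite_II N)) => n nA /=.
by rewrite ltnNge; apply/negP => /NA.
Qed.

Theorem proposition5p16 (R : realType) (T : nat -> tensor R[i])
    (hT : approx_geometric T) :
  kronecker_scaling T.
Proof.
move=> delta delta_gt0; apply: near_infty_infinite_set.
case: hT => [[k _ Tk]|[_ [k k_sub Tk]]].
  (* Degenerate case: [T m] is zero for every [m > 0], so the empty sum works for each [d > 0],
     along all positive integers. *)
  exists 1%N => // d /= d_gt0; split=> //; exists 0%N, 1%N; split=> //.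
  exists 1%N => // m /= m_gt0; rewrite add0n muln1.
  exists 0%N, (fun=> 0); split; [exact: powR_ge0| |by case].
  rewrite big_ord0; have [+ _] := Tk m.
  by rewrite gtn_eqF//; apply: tensor_le_kron_unit0.
have kd_lt : \forall d \near \oo, (k d)%:R / d%:R < delta :> R.
  exact: (cvgr_lt _ k_sub).
near=> d.
have d_gt0 : (0 < d)%N by near: d; exists 1%N.
have d_gt0R : 0 < d%:R :> R by rewrite ltr0n.
(* The progression is that of the multiples of [d]; [m = 0] is left out because approximate
   geometricity concerns products of at least one factor. *)
split=> //; exists 0%N, d; split=> //; exists 1%N => // m /= m_gt0.
rewrite add0n.
(* With all [m] indices equal to [d], the product is [tensor_pow (T d) m] and the error exponent is
   [m * k d]. *)
have [_] := Tk m (fun=> d) m_gt0.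
rewrite !sum_nat_const card_ord big_const_ord => Tmd.
have [S [TS S_le]] := tensor_le_kron_rank
  (rank_le_pow (m * k d) (rank_le_unit_tensor _ 2)) Tmd.
exists (2 ^ (m * k d))%N, S; split=> [//||l].
(* Comparing exponents and cancelling [m] leaves [k d <= delta * d], which holds by the choice of
   [d]. *)
- rewrite natrX -powR_mulrn// ler_powR ?ler1n// !natrM mulrCA ler_wpM2l//.
  rewrite -ler_pdivrMr//; apply: ltW.
  by near: d.
- exact: TS.
(* Here [n / d] is exactly [m], so the bound on [s] reads [m <= (1 + delta) * m]. *)
exists m; last exact: S_le.
by rewrite natrM mulrA mulfK ?gt_eqF// ler_peMl// lerDl ltW.
Unshelve. all: by end_near.
Qed.
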